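(* Every entropy game (played on a finite non-blocking arena) is determined, and both Despot and Tribune possess positional optimal strategies.
   Context: Entropy game (EG). An arena is a tuple $(D,T,\Sigma,\Delta)$ where $D$ and $T$ are disjoint finite nonempty sets of vertices, $\Sigma$ is a finite alphabet of actions and $\Delta\subseteq (T\times\Sigma\times D)\cup(D\times\Sigma\times T)$. The arena is assumed non-blocking: from every vertex there is at least one transition. A play is a finite or infinite word $d_0a_0t_0b_0d_1a_1t_1b_1\cdots$ in $(D\cdot\Sigma\cdot T\cdot\Sigma)^\infty$ with $(d_i,a_i,t_i)\in\Delta$ and $(t_i,b_i,d_{i+1})\in\Delta$ (the initial vertex $d_0\in D$ is arbitrary). A strategy of Despot is a function $\sigma:(D\cdot\Sigma\cdot T\cdot\Sigma)^*\cdot D\to\Sigma$ choosing the action $a$ at the end of each finite play ending in a vertex $d\in D$; a strategy of Tribune is a function $\tau:(D\cdot\Sigma\cdot T\cdot\Sigma)^*\cdot D\cdot\Sigma\cdot T\to\Sigma$ choosing the action at the end of each finite play ending in a vertex of $T$. Strategies must not block: the chosen action must label at least one transition of $\Delta$ from the current vertex. A strategy is positional if it depends only on the current vertex. $L(\sigma,\tau)$ is the set of all infinite plays (with any initial vertex in $D$ and any resolution of the nondeterministic choice of successor vertices) in which all actions at $D$-vertices are chosen by $\sigma$ and all actions at $T$-vertices are chosen by $\tau$. With $\mathrm{pref}_{n}(L)$ denoting the set of length-$n$ prefixes of words of $L$, the payoff is $$P(\sigma,\tau)=\limsup_{n\to\infty}\big|\mathrm{pref}_{4n}(L(\sigma,\tau))\big|^{1/n}.$$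 Despot minimizes and Tribune maximizes the payoff. The game is determined with value $V$ if $\inf_\sigma\sup_\tau P(\sigma,\tau)=\sup_\tau\inf_\sigma P(\sigma,\tau)=V$. A Despot strategy $\sigma$ is optimal if $P(\sigma,\tau)\le V$ for all $\tau$; a Tribune strategy $\tau$ is optimal if $P(\sigma,\tau)\ge V$ for all $\sigma$. *)

(* Defs.v *)
From HB Require Import structures.
From mathcomp Require Import all_boot all_order all_algebra.
From mathcomp Require Import all_classical all_reals all_analysis.

Set Implicit Arguments.
Unset Strict Implicit.
Unset Printing Implicit Defensive.

Import Order.TTheory GRing.Theory Num.Theory.
Import numFieldNormedType.Exports.
Local Open Scope classical_set_scope.
Local Open Scope ring_scope.

(* Despot's and Tribune's vertices are separate types, hence disjoint, and the
   transition relation, a subset of (T * S * D) + (D * S * T), is given by its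
   two components. *)
Record arena := Arena {
  despot : finType;
  tribune : finType;
  alphabet : finType;
  despot_trans : {set despot * alphabet * tribune};
  tribune_trans : {set tribune * alphabet * despot};
  despot_nonempty : (0 < #|despot|)%N;
  tribune_nonempty : (0 < #|tribune|)%N;
  despot_nonblocking :
    forall d : despot, exists a t, (d, a, t) \in despot_trans;
  tribune_nonblocking :
    forall t : tribune, exists b d, (t, b, d) \in tribune_trans }.

(* A round (d, a, t, b) is four consecutive letters of a play, so a word
   of (D . S . T . S)^* of length 4n is a sequence of n rounds. *)
Definition round (A : arena) : finType :=
  (despot A * alphabet A * tribune A * alphabet A)%type.

(* The argument h is the sequence of completed rounds; the remaining arguments
   are the letters of the current, incomplete round. *)
Record despot_strategy (A : arena) := DespotStrategy {
  despot_choice :> seq (round A) -> despot A -> alphabet A;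
  despot_choiceP : forall h d,
    exists t, (d, despot_choice h d, t) \in despot_trans A }.

Record tribune_strategy (A : arena) := TribuneStrategy {
  tribune_choice :>
    seq (round A) -> despot A -> alphabet A -> tribune A -> alphabet A;
  tribune_choiceP : forall h d a t,
    exists d', (t, tribune_choice h d a t, d') \in tribune_trans A }.

Definition despot_positional (A : arena) (s : despot_strategy A) : Prop :=
  exists f : despot A -> alphabet A, forall h d, s h d = f d.

Definition tribune_positional (A : arena) (r : tribune_strategy A) : Prop :=
  exists f : tribune A -> alphabet A, forall h d a t, r h d a t = f t.

Section Plays.
Variable A : arena.

Implicit Type p : nat -> round A.

Definition dvertex p (i : nat) : despot A := (p i).1.1.1.
Definition daction p (i : nat) : alphabet A := (p i).1.1.2.
Definition tvertex p (i : nat) : tribune A := (p i).1.2.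
Definition taction p (i : nat) : alphabet A := (p i).2.

Definition infinite_play p : Prop := forall i,
  (dvertex p i, daction p i, tvertex p i) \in despot_trans A /\
  (tvertex p i, taction p i, dvertex p i.+1) \in tribune_trans A.

Definition plays (s : despot_strategy A) (r : tribune_strategy A) :
    set (nat -> round A) :=
  [set p | infinite_play p /\ forall i,
     daction p i = s (mkseq p i) (dvertex p i) /\
     taction p i = r (mkseq p i) (dvertex p i) (daction p i) (tvertex p i)].

(* The prefixes of n rounds, that is, of 4n letters. *)
Definition prefixes (L : set (nat -> round A)) (n : nat) :
    {set n.-tuple (round A)} :=
  [set w : n.-tuple (round A) |
     `[< exists2 p, L p & mkseq p n = w >] ]%SET.

Variable R : realType.

(* Extended-real valued only so that limsup, inf and sup are total; the
   sequence is bounded by #|round A|. *)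
Definition payoff (s : despot_strategy A) (r : tribune_strategy A) : \bar R :=
  limn_esup (fun n => ((#|prefixes (plays s r) n|%:R `^ n%:R^-1 : R)%:E)).

Definition has_value (V : \bar R) : Prop :=
  ereal_inf [set ereal_sup [set payoff s r | r in [set: tribune_strategy A]]
            | s in [set: despot_strategy A]] = V /\
  ereal_sup [set ereal_inf [set payoff s r | s in [set: despot_strategy A]]
            | r in [set: tribune_strategy A]] = V.

Definition despot_optimal (V : \bar R) (s : despot_strategy A) : Prop :=
  forall r, (payoff s r <= V)%E.

Definition tribune_optimal (V : \bar R) (r : tribune_strategy A) : Prop :=
  forall s, (V <= payoff s r)%E.

End Plays.

(* Main.v *)
Require Import Defs.
From mathcomp Require Import all_boot all_order all_algebra.
From mathcomp Require Import all_classical all_reals all_analysis.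
From mathcomp Require Import lra.

(* Let F u d be the least, over Despot's actions at d, of the sum over the
   resulting Tribune vertices t of the greatest, over Tribune's actions at t, of
   the sum of u over the resulting Despot vertices.  Let V be the infimum of
   the l such that F u <= l u for some u >= 1.  Weighting each n-round history by
   the value of u at its last vertex, Despot's minimizing actions for such a u
   keep the number of histories below C l^n, while a nonzero u >= 0 with
   F u >= l u gives Tribune actions keeping it above c l^n.  For every l < V a
   u of the second kind exists, up to an arbitrarily small loss on l: iterate
   y |-> 1 + F y / l from 0; if the iterates are bounded, one of them satisfies
   F y <= l y, which contradicts l < V; otherwise take a late iterate and set its
   bounded coordinates to 0.  There are only finitely many positional
   strategies, so one of them works for all errors e > 0. *)

Set Implicit Arguments.
Unset Strict Implicit.
Unset Printing Implicit Defensive.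

Import Order.TTheory GRing.Theory Num.Theory.
Local Open Scope classical_set_scope.
Local Open Scope ring_scope.

(** * Growth rates of geometrically bounded sequences *)

Section GrowthRate.
Variable R : realType.
Implicit Types (a b c : R) (N : nat -> nat).

(** By Bernoulli's inequality [(b / a) ^+ n] is at least [1 + n * e] with [e = b / a - 1], which
    outgrows every constant. *)
Lemma geometric_eventually_le a b c : 0 < a -> a < b ->
  exists k, forall n, (k <= n)%N -> c * a ^+ n <= b ^+ n.
Proof.
move=> a0 ab; set e := b / a - 1.
have e0 : 0 < e by rewrite subr_gt0 ltr_pdivlMr// mul1r.
have bern n : 1 + n%:R * e <= (b / a) ^+ n.
  elim: n => [|n IH]; first by rewrite mul0r addr0 expr0.
  have -> : b / a = 1 + e by rewrite /e addrC subrK.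
  rewrite exprS; apply: (@le_trans _ _ ((1 + e) * (1 + n%:R * e))).
    rewrite -natr1 mulrDl mul1r.
    have : 0 <= n%:R * e * e by rewrite !mulr_ge0// ?ler0n// ltW.
    lra.
  apply: ler_wpM2l; first lra.
  by have -> : 1 + e = b / a by rewrite /e addrC subrK.
exists (Num.bound `|c / e|) => n kn.
have -> : b ^+ n = (b / a) ^+ n * a ^+ n by rewrite -exprMn divfK// gt_eqF.
apply: ler_wpM2r; first by rewrite exprn_ge0// ltW.
apply: le_trans (bern n); rewrite -lerBlDl -ler_pdivrMr//.
apply: (@le_trans _ _ `|c / e|).
  by apply: le_trans (ler_norm _); rewrite ler_pM2r ?invr_gt0//; lra.
apply: le_trans (ltW (archi_boundP (normr_ge0 _))) _.
by rewrite ler_nat.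
Qed.

Let root N n : \bar R := ((N n)%:R `^ n%:R^-1)%:E.

Lemma limn_esup_root_le N c a : 0 <= a ->
  (forall n, (N n)%:R <= c * a ^+ n) -> (limn_esup (root N) <= a%:E)%E.
Proof.
move=> a0 Na; apply/lee_addgt0Pr => e e0.
have [k kP] := @geometric_eventually_le (a + e / 2) (a + e) c
  ltac:(lra) ltac:(lra).
have c0 : 0 <= c by apply: le_trans (le_trans (ler0n _ _) (Na 0%N)) _; rewrite expr0 mulr1.
(* The limsup is at most the supremum over any tail. The tail omits [n = 0], where the exponent
   [0^-1] is [0] and the root does not undo the power. *)
apply: (@le_trans _ _ (ereal_sup (root N @` [set n | (maxn 1 k <= n)%N]))).
  apply: ereal_inf_lbound; exists [set n | (maxn 1 k <= n)%N] => //; exact: nbhs_infty_ge.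
apply: ge_ereal_sup => _ [n /= + <-]; rewrite geq_max => /andP[n0 kn].
rewrite /root -EFinD lee_fin.
have ae : 0 <= a + e by rewrite addr_ge0// ltW.
have -> : a + e = ((a + e) ^+ n) `^ n%:R^-1.
  by rewrite -powR_mulrn// -powRrM mulfV ?powRr1// pnatr_eq0 -lt0n.
apply: ge0_ler_powR; rewrite ?invr_ge0 ?ler0n ?nnegrE ?exprn_ge0//.
apply: le_trans (kP n kn); apply: le_trans (Na n) _.
by apply: ler_wpM2l => //; apply: lerXn2r; rewrite ?nnegrE ?lerDl; lra.
Qed.

Lemma limn_esup_root_ge N c a : 0 < c ->
  (forall n, c * a ^+ n <= (N n)%:R) -> (a%:E <= limn_esup (root N))%E.
Proof.
move=> c0 Na; apply/lee_subgt0Pr => e e0.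
apply: le_ereal_inf_tmp => _ [V [k _ kV] <-].
suff [n kn nP] : exists2 n, (k <= n)%N & a - e <= (N n)%:R `^ n%:R^-1.
  apply: le_ereal_sup_tmp; exists (root N n); last first.
    by rewrite -EFinD lee_fin.
  by exists n => //; exact: kV.
have [ae|ae] := leP (a - e) 0.
  by exists k => //; apply: le_trans ae _; exact: powR_ge0.
have [m mP] := @geometric_eventually_le (a - e) a c^-1 ae ltac:(lra).
pose n := maxn 1 (maxn k m).
have n0 : (0 < n)%N by rewrite leq_max.
exists n; first by rewrite /n !leq_max leqnn orbT.
have -> : a - e = ((a - e) ^+ n) `^ n%:R^-1.
  by rewrite -powR_mulrn ?ltW// -powRrM mulfV ?powRr1 ?ltW// pnatr_eq0 -lt0n.
apply: ge0_ler_powR; rewrite ?invr_ge0 ?ler0n ?nnegrE ?ler0n//.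
  exact: exprn_ge0 (ltW ae).
apply: le_trans (Na n); rewrite -ler_pdivrMl//.
by apply: mP; rewrite /n !leq_max leqnn !orbT.
Qed.

End GrowthRate.

(** If every [i] failed at some error [g i], monotonicity would make every [i] fail at the least of
    these finitely many errors. *)
Lemma fin_uniform_choice (I : finType) (R : realType) (P : I -> R -> Prop) :
  (forall i d e, d <= e -> P i d -> P i e) ->
  (forall e, 0 < e -> exists i, P i e) -> exists i, forall e, 0 < e -> P i e.
Proof.
move=> mono ex; apply: contrapT => nP.
have bad i : exists e, 0 < e /\ ~ P i e.
  apply: contrapT => nb; apply: nP; exists i => e e0.
  by apply: contrapT => nPe; apply: nb; exists e.
have [g gP] := choice bad.
have [|i Pi] := ex (\big[Order.min/1]_i g i).
  by apply: lt_bigmin => // i _; have [] := gP i.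
have [_ []] := gP i; apply: mono Pi; exact: bigmin_le_cond.
Qed.

(** * Superharmonic or subharmonic vectors of a monotone map *)

Section MonotoneMap.
Variables (R : realType) (D : finType) (F : (D -> R) -> D -> R) (C : R).
Hypothesis F_mono : forall u v, (forall d, u d <= v d) -> forall d, F u d <= F v d.
Hypothesis F_shift : forall k u d, 0 <= k -> F (fun e => u e + k) d <= F u d + C * k.
Hypothesis F_ge0 : forall d, 0 <= F (fun=> 0) d.
Hypothesis C_ge0 : 0 <= C.

Lemma super_or_subharmonic (l : R) : 0 < l ->
  (exists u, (forall d, 1 <= u d) /\ forall d, F u d <= l * u d) \/
  forall e, 0 < e -> exists u,
    [/\ forall d, 0 <= u d, exists d, 0 < u d & forall d, (l - e) * u d <= F u d].
Proof.
move=> l0.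
pose y n := iter n (fun (u : D -> R) d => 1 + F u d / l) (fun=> 0).
have yS n d : y n.+1 d = 1 + F (y n) d / l by [].
have Fy n d : F (y n) d = l * (y n.+1 d - 1).
  by rewrite yS addrC addKr mulrC divfK// gt_eqF.
have F_ge u : (forall d, 0 <= u d) -> forall d, 0 <= F u d.
  by move=> u0 d; apply: le_trans (F_ge0 d) _; apply: F_mono.
have y0 n d : 0 <= y n d.
  elim: n d => [|n IH] d //; rewrite yS addr_ge0// divr_ge0 ?(ltW l0)//; exact: F_ge.
have y1 n d : 1 <= y n.+1 d.
  by rewrite yS lerDl divr_ge0 ?(ltW l0)//; exact: F_ge.
have ymonoS n d : y n d <= y n.+1 d.
  elim: n d => [|n IH] d; first exact: y0.
  by rewrite !yS lerD2l ler_pM2r ?invr_gt0//; exact: F_mono.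
have ymono m n d : (m <= n)%N -> y m d <= y n d.
  move=> /subnKC <-; elim: (n - m)%N => [|k IH]; rewrite ?addn0//.
  by rewrite addnS; exact: le_trans IH (ymonoS _ _).
pose bdd d := exists2 K, 0 <= K & forall n, y n d <= K.
have [K [K0 KP]] : exists K, 0 <= K /\ forall d, bdd d -> forall n, y n d <= K.
  have : forall d, exists K, 0 <= K /\ (bdd d -> forall n, y n d <= K).
    move=> d; have [[K K0 KP]|nb] := pselect (bdd d); first by exists K.
    by exists 0; split.
  move=> /choice[k kP]; exists (\sum_d k d); split.
    by apply: sumr_ge0 => d _; have [] := kP d.
  move=> d bd n; have [k0 /(_ bd n) h] := kP d; apply: le_trans h _.
  by rewrite (bigD1 d)//= lerDl sumr_ge0// => j _; have [] := kP j.
have [allb|] := pselect (forall d, bdd d).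
  left.
  (* By [Fy], an increment of at most [1] after [y n.+1] means [F (y n.+1) <= l * y n.+1]; the index
     [n.+1] makes all entries at least [1]. *)
  suff [n nP] : exists n, forall d, y n.+2 d <= y n.+1 d + 1.
    exists (y n.+1); split => // d; rewrite Fy ler_pM2l//.
    by rewrite lerBlDr.
  apply: contrapT => nP.
  (* Otherwise each step raises some coordinate by more than [1] and lowers none, so the sum of the
     coordinates is unbounded. *)
  have grow n : n%:R <= \sum_d y n.+1 d.
    elim: n => [|n IH]; first by apply: sumr_ge0 => d _.
    have [d dP] : exists d, y n.+1 d + 1 < y n.+2 d.
      apply: contrapT => nd; apply: nP; exists n => d.
      by rewrite leNgt; apply/negP => ?; apply: nd; exists d.
    rewrite -natr1; apply: (@le_trans _ _ (\sum_d y n.+1 d + 1)); first by rewrite lerD2r.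
    rewrite [leLHS](_ : _ = (y n.+1 d + 1) + \sum_(j | j != d) y n.+1 j);
      last by rewrite (bigD1 d)// addrAC.
    by rewrite [leRHS](bigD1 d)//; apply: lerD; [exact: ltW dP | apply: ler_sum => j _].
  have := grow (Num.bound (\sum_(d : D) K)).
  have : \sum_d y (Num.bound (\sum_(d : D) K)).+1 d <= \sum_(d : D) K.
    by apply: ler_sum => d _; exact: KP.
  have : 0 <= \sum_(d : D) K by apply: sumr_ge0.
  move=> /archi_boundP; lra.
move=> nall; right => e e0.
have [d0 nb0] : exists d, ~ bdd d.
  by apply: contrapT => h; apply: nall => d; apply: contrapT => ?; apply: h; exists d.
(* For entries above [M], the slack [e * y n d] pays for the [l] lost in [Fy] and for the [C * K]
   lost by zeroing the coordinates bounded by [K]. *)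
pose M := 1 + (l + C * K) / e.
have M1 : 1 <= M by rewrite lerDl divr_ge0 ?addr_ge0 ?mulr_ge0// ltW.
have : forall d, exists n, ~ bdd d -> M <= y n d.
  move=> d; have [bd|nb] := pselect (bdd d); first by exists 0%N.
  apply: contrapT => h; apply: nb; exists M => [|n]; first by rewrite (le_trans _ M1).
  by rewrite leNgt; apply/negP => /ltW ?; apply: h; exists n.
move=> /choice[k kP]; pose n := \max_d k d.
have yM d : ~ bdd d -> M <= y n d.
  by move=> /kP h; apply: le_trans h _; apply: ymono; exact: leq_bigmax.
pose u d := if `[< bdd d >] then 0 else y n d.
have u0 d : 0 <= u d by rewrite /u; case: ifP.
exists u; split => //.
  exists d0; rewrite /u; case: asboolP => // _.
  by apply: lt_le_trans (yM _ nb0); lra.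
move=> d; rewrite {1}/u; case: asboolP => [_|nb]; first by rewrite mulr0; exact: F_ge.
have le1 : F (y n) d <= F u d + C * K.
  apply: le_trans (F_shift _ _ K0); apply: F_mono => j; rewrite /u.
  by case: asboolP => [bj|_]; rewrite ?add0r ?lerDl//; exact: KP.
have := yM _ nb; rewrite /M => yMd.
have : l + C * K <= e * y n d.
  rewrite -ler_pdivrMl// mulrC; lra.
have : l * (y n d - 1) <= F (y n) d by rewrite Fy ler_pM2l// lerD2r.
rewrite mulrBl; lra.
Qed.

End MonotoneMap.

(** * Histories and prefixes of plays *)

Section Counting.
Variables (A : arena) (s : despot_strategy A) (r : tribune_strategy A).
Implicit Types (p : seq (round A) * despot A) (q : tribune A * despot A).

Definition answer p (t : tribune A) : alphabet A := r p.1 p.2 (s p.1 p.2) t.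

Definition moves p : seq (tribune A * despot A) :=
  [seq q <- enum {: tribune A * despot A} |
     ((p.2, s p.1 p.2, q.1) \in despot_trans A) &&
     ((q.1, answer p q.1, q.2) \in tribune_trans A)].

Definition extend p q : seq (round A) * despot A :=
  (rcons p.1 (p.2, s p.1 p.2, q.1, answer p q.1), q.2).

(* The second component is the vertex reached after the n rounds, so prefixes
   appear once for each possible successor of their last Tribune vertex. *)
Fixpoint histories n : seq (seq (round A) * despot A) :=
  if n is m.+1 then [seq extend p q | p <- histories m, q <- moves p]
  else [seq ([::], d) | d <- enum (despot A)].

Lemma mem_moves p q : (q \in moves p) =
  ((p.2, s p.1 p.2, q.1) \in despot_trans A) &&
  ((q.1, answer p q.1, q.2) \in tribune_trans A).
Proof. by rewrite mem_filter mem_enum andbT. Qed.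

Lemma moves_ex p : exists q, q \in moves p.
Proof.
have [t ht] := despot_choiceP s p.1 p.2.
have [d hd] := tribune_choiceP r p.1 p.2 (s p.1 p.2) t.
by exists (t, d); rewrite mem_moves ht.
Qed.

(** The last round records the previous vertex and the Tribune vertex of the move, so predecessor
    and move can be read off an extended history. *)
Lemma histories_uniq n : uniq (histories n).
Proof.
elim: n => [|n IH] /=; first by rewrite map_inj_uniq ?enum_uniq// => d e [].
apply: allpairs_uniq_dep => // [p _|]; first by rewrite filter_uniq ?enum_uniq.
move=> [[h d] [t e]] [[h' d'] [t' e']] _ _ /= [] /rcons_inj[-> -> _ -> _] -> //.
Qed.

Lemma mkseq_histories (f : nat -> round A) n :
  plays s r f -> (mkseq f n, dvertex f n) \in histories n.
Proof.
move=> [fP fsr]; elim: n => [|n IH] /=; first by rewrite map_f ?mem_enum.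
apply/allpairsPdep; exists (mkseq f n, dvertex f n), (tvertex f n, dvertex f n.+1).
have [e1 e2] := fsr n; have [f1 f2] := fP n; split=> //.
  by rewrite mem_moves /answer /= -e1 -e2 f1.
rewrite /extend /answer /= -e1 -e2 mkseqS /dvertex /daction /tvertex /taction.
by case: (f n) => [[[]]].
Qed.

(** Prefixes are taken of infinite plays only; since no vertex blocks, every finite history
    continues forever. *)
Lemma histories_chain n p : p \in histories n ->
  exists c : nat -> seq (round A) * despot A,
    [/\ (c 0%N).1 = [::], c n = p &
        forall k, exists q, q \in moves (c k) /\ c k.+1 = extend (c k) q].
Proof.
have [nxt nxtP] := choice moves_ex.
pose go k p := iter k (fun p => extend p (nxt p)) p.
elim: n p => [|n IH] p /=.
  case/mapP=> d _ ->; exists (go^~ ([::], d)); split=> // k.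
  by exists (nxt (go k ([::], d))).
case/allpairsPdep=> p' [q [/IH[c [c0 cn cP]] qm ->]].
(* The chain [c] is followed up to [n], the move [q] leads to index [n.+1], and the moves [nxt] take
   over from there. *)
exists (fun k => if (k <= n)%N then c k else go (k - n.+1)%N (extend p' q)).
split=> //; first by rewrite ltnn subnn.
move=> k; case: (ltngtP k n) => [kn|kn|->].
- exact: cP.
- by rewrite subSn//; exists (nxt (go (k - n.+1)%N (extend p' q))).
- by rewrite subnn; exists q; rewrite cn.
Qed.

Lemma histories_mkseq n p : p \in histories n ->
  exists2 f, plays s r f & mkseq f n = p.1.
Proof.
case/histories_chain=> c [c0 cn] /choice[q /all_and2[qm cS]].
pose f k : round A := ((c k).2, s (c k).1 (c k).2, (q k).1, answer (c k) (q k).1).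
have cf k : mkseq f k = (c k).1.
  by elim: k => [|k IH]; rewrite ?c0// mkseqS IH cS.
exists f; last by rewrite cf cn.
split=> k; last by rewrite cf.
have := qm k; rewrite mem_moves => /andP[m1 m2].
by rewrite /dvertex /f cS.
Qed.

Lemma card_prefixes_le n : (#|prefixes (plays s r) n| <= size (histories n))%N.
Proof.
rewrite -(size_map fst) cardE -(size_map val).
apply: uniq_leq_size; first by rewrite (map_inj_uniq val_inj) enum_uniq.
move=> w /mapP[v]; rewrite mem_enum inE => /asboolP[f fP fv] ->.
rewrite (_ : val v = mkseq f n); last exact: esym.
by apply/mapP; exists (mkseq f n, dvertex f n) => //; exact: mkseq_histories.
Qed.

(** A history is a prefix with a final vertex; the factor [#|despot A|] does not affect the growth
    rate. *)
Lemma size_histories_le n :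
  (size (histories n) <= #|prefixes (plays s r) n| * #|despot A|)%N.
Proof.
rewrite cardE (cardE (despot A))
  -(size_allpairs (fun (v : n.-tuple (round A)) (d : despot A) => (tval v, d))).
apply: uniq_leq_size; first exact: histories_uniq.
move=> [h d] /histories_mkseq[f fP /= fh].
have sf : size (mkseq f n) == n by rewrite size_mkseq.
apply/allpairsP; exists (Tuple sf, d); rewrite !mem_enum; split=> //; last by rewrite -fh.
by rewrite inE; apply/asboolP; exists f.
Qed.

End Counting.

(** * Weighted counts of histories and bounds on the payoff *)

Section Game.
Variables (R : realType) (A : arena).
Implicit Types (u : despot A -> R).

Definition tribune_sum u t b : R := \sum_(d | (t, b, d) \in tribune_trans A) u d.

Lemma histories_sumS (s : despot_strategy A) (r : tribune_strategy A) u n :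
  \sum_(p <- histories s r n.+1) u p.2 =
  \sum_(p <- histories s r n) \sum_(t | (p.2, s p.1 p.2, t) \in despot_trans A)
    tribune_sum u t (answer s r p t).
Proof.
rewrite big_allpairs_dep; apply: eq_bigr => p _.
by rewrite pair_big_dep /= big_filter big_enum_cond.
Qed.

Section Bounds.
Variables (s : despot_strategy A) (r : tribune_strategy A).

Lemma payoff_le u l : 0 <= l -> (forall d, 1 <= u d) ->
  (forall h d, \sum_(t | (d, s h d, t) \in despot_trans A)
     tribune_sum u t (r h d (s h d) t) <= l * u d) ->
  (payoff R s r <= l%:E)%E.
Proof.
move=> l0 u1 ul; apply: (@limn_esup_root_le _ _ (\sum_d u d)) => // n.
apply: (@le_trans _ _ (\sum_(p <- histories s r n) u p.2)).
  apply: (@le_trans _ _ (size (histories s r n))%:R).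
    by rewrite ler_nat card_prefixes_le.
  rewrite -sum1_size natr_sum; exact: ler_sum.
elim: n => [|n IH]; first by rewrite big_map big_enum expr0 mulr1.
rewrite histories_sumS exprS mulrCA; apply: le_trans (ler_wpM2l l0 IH).
by rewrite mulr_sumr; apply: ler_sum => p _; exact: ul.
Qed.

Lemma payoff_ge u l : (forall d, 0 <= u d) -> (exists d, 0 < u d) ->
  (forall h d, l * u d <= \sum_(t | (d, s h d, t) \in despot_trans A)
     tribune_sum u t (r h d (s h d) t)) ->
  (l%:E <= payoff R s r)%E.
Proof.
move=> u0 [d0 ud0].
(* A negative [l] reduces to [0]; the induction below multiplies inequalities by [l]. *)
wlog l0 : l / 0 <= l => [hw ul|ul].
  have [l0|/ltW l0] := leP 0 l; first exact: hw.
  apply: (@le_trans _ _ 0%:E); first by rewrite lee_fin.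
  apply: hw => // h d; rewrite mul0r; apply: sumr_ge0 => t _.
  exact: sumr_ge0.
(* [U] is the total weight of the initial histories and also bounds each single weight, so it
   cancels and only the factor [#|despot A|] remains. *)
set U := \sum_d u d.
have U0 : 0 < U by rewrite /U (bigD1 d0)//= ltr_wpDr// sumr_ge0.
have D0 : 0 < (#|despot A|%:R : R) by rewrite ltr0n despot_nonempty.
apply: (@limn_esup_root_ge _ _ (#|despot A|%:R^-1)); first by rewrite invr_gt0.
move=> n; rewrite mulrC ler_pdivrMr// -(ler_pM2r U0).
apply: (@le_trans _ _ (\sum_(p <- histories s r n) u p.2)).
  elim: n => [|n IH]; first by rewrite big_map big_enum expr0 mul1r.
  rewrite histories_sumS exprS -mulrA; apply: le_trans (ler_wpM2l l0 IH) _.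
  by rewrite mulr_sumr; apply: ler_sum => p _; exact: ul.
apply: (@le_trans _ _ ((size (histories s r n))%:R * U)).
  rewrite -sum1_size natr_sum mulr_suml; apply: ler_sum => p _.
  by rewrite mul1r /U (bigD1 p.2)//= lerDl sumr_ge0.
by rewrite ler_pM2r// -natrM ler_nat size_histories_le.
Qed.

End Bounds.

(** * The min-max operator of one round *)

Definition despot_legal d (a : alphabet A) :=
  [exists t, (d, a, t) \in despot_trans A].
Definition tribune_legal t (b : alphabet A) :=
  [exists d, (t, b, d) \in tribune_trans A].

Lemma despot_legal_ex d : exists a, despot_legal d a.
Proof. by have [a [t at_]] := despot_nonblocking d; exists a; apply/existsP; exists t. Qed.

Lemma tribune_legal_ex t : exists b, tribune_legal t b.
Proof. by have [b [d bd]] := tribune_nonblocking t; exists b; apply/existsP; exists d. Qed.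

(** Each Tribune vertex contributes its own summand, so one choice per vertex maximizes all the sums
    at once, whatever the history. This is why positional play suffices. *)
Definition tribune_best u t : alphabet A :=
  [arg max_(b > xchoose (tribune_legal_ex t) | tribune_legal t b) tribune_sum u t b]%O.

Definition despot_sum u d a : R :=
  \sum_(t | (d, a, t) \in despot_trans A) tribune_sum u t (tribune_best u t).

Definition despot_best u d : alphabet A :=
  [arg min_(a < xchoose (despot_legal_ex d) | despot_legal d a) despot_sum u d a]%O.

(** This is the map [F] to which [super_or_subharmonic] is applied. *)
Definition round_op u d : R := despot_sum u d (despot_best u d).

Lemma tribune_bestP u t : tribune_legal t (tribune_best u t) /\
  forall b, tribune_legal t b -> tribune_sum u t b <= tribune_sum u t (tribune_best u t).
Proof. by rewrite /tribune_best; case: arg_maxP => //; exact: xchooseP. Qed.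

Lemma despot_bestP u d : despot_legal d (despot_best u d) /\
  forall a, despot_legal d a -> round_op u d <= despot_sum u d a.
Proof. by rewrite /round_op /despot_best; case: arg_minP => //; exact: xchooseP. Qed.

(** Despot's best action for [v] is tried against [u], and Tribune's best action for [u] against
    [v]; legality does not depend on the weights. *)
Lemma round_op_mono u v : (forall d, u d <= v d) ->
  forall d, round_op u d <= round_op v d.
Proof.
move=> uv d; have [l _] := despot_bestP v d.
have [_ /(_ _ l) h] := despot_bestP u d; apply: le_trans h _.
apply: ler_sum => t _; have [lt _] := tribune_bestP u t.
have [_ /(_ _ lt)] := tribune_bestP v t; apply: le_trans.
exact: ler_sum.
Qed.

Lemma round_op_ge0 d : 0 <= round_op (fun=> 0) d.
Proof. by apply: sumr_ge0 => t _; apply: sumr_ge0. Qed.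

Lemma sum_cst_le (I : finType) (P : pred I) (k : R) :
  0 <= k -> \sum_(i | P i) k <= #|I|%:R * k.
Proof. by move=> k0; rewrite sumr_const mulr_natl ler_wpMn2l// max_card. Qed.

(** With Despot's best action for [u], at most [#|tribune A|] vertices are reached, each with at
    most [#|despot A|] successors gaining [k]. *)
Lemma round_op_shift k u d : 0 <= k ->
  round_op (fun e => u e + k) d <= round_op u d + (#|tribune A|%:R * #|despot A|%:R) * k.
Proof.
move=> k0; have [l _] := despot_bestP u d.
have [_ /(_ _ l) h] := despot_bestP (fun e => u e + k) d; apply: le_trans h _.
apply: (@le_trans _ _ (\sum_(t | (d, despot_best u d, t) \in despot_trans A)
   (tribune_sum u t (tribune_best u t) + #|despot A|%:R * k))).
  apply: ler_sum => t _; rewrite /tribune_sum big_split /=; apply: lerD.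
    have [lt _] := tribune_bestP (fun e => u e + k) t.
    by have [_ /(_ _ lt)] := tribune_bestP u t.
  exact: sum_cst_le.
rewrite big_split /= lerD2l -mulrA; apply: sum_cst_le.
by rewrite mulr_ge0.
Qed.

(** * The value and the positional optimal choices *)

Definition superharmonic_value (l : R) : Prop :=
  exists u, (forall d, 1 <= u d) /\ forall d, round_op u d <= l * u d.

Definition game_value : R := inf [set l | superharmonic_value l].

Lemma superharmonic_value_ge0 l : superharmonic_value l -> 0 <= l.
Proof.
move=> [u [u1 ul]]; have /card_gt0P[d _] := despot_nonempty A.
have ud : 0 < u d by apply: lt_le_trans (u1 d).
rewrite -(pmulr_lge0 _ ud); apply: le_trans (ul d).
apply: le_trans (round_op_ge0 d) _; apply: round_op_mono => e.
exact: le_trans (u1 e).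
Qed.

Lemma has_inf_superharmonic_value : has_inf [set l | superharmonic_value l].
Proof.
split; last by exists 0 => l; exact: superharmonic_value_ge0.
(* For the constant vector [1], the sum of the nonnegative values of the operator dominates each of
   them. *)
exists (\sum_d round_op (fun=> 1) d), (fun=> 1); split=> // d; rewrite mulr1.
have op_ge0 e : 0 <= round_op (fun=> 1) e.
  by apply: le_trans (round_op_ge0 e) _; apply: round_op_mono.
by rewrite (bigD1 d)//= lerDl sumr_ge0.
Qed.

Lemma superharmonic_above e : 0 < e -> superharmonic_value (game_value + e).
Proof.
move=> e0; have [l [u [u1 ul]] lV] := inf_adherent e0 has_inf_superharmonic_value.
exists u; split=> // d; apply: le_trans (ul d) _.
by apply: ler_wpM2r (ltW lV); apply: le_trans (u1 d).
Qed.

(** The level [game_value - e / 2] lies below the infimum, which excludes the superharmonic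
    alternative; the other half of [e] absorbs the loss in the second one. At a nonpositive level
    the constant [1] works. *)
Lemma subharmonic_below e : 0 < e -> exists u,
  [/\ forall d, 0 <= u d, exists d, 0 < u d &
      forall d, (game_value - e) * u d <= round_op u d].
Proof.
move=> e0; have [le0|lt0] := leP (game_value - e / 2) 0.
  exists (fun=> 1); split=> [//||d].
    by have /card_gt0P[d _] := despot_nonempty A; exists d.
  apply: (@le_trans _ _ 0); first by rewrite mulr1; lra.
  by apply: le_trans (round_op_ge0 d) _; apply: round_op_mono.
have C0 : 0 <= #|tribune A|%:R * #|despot A|%:R :> R by rewrite mulr_ge0.
have [h|h] := super_or_subharmonic round_op_mono round_op_shift round_op_ge0 C0 lt0.
  have : game_value <= game_value - e / 2.
    by apply: ge_inf => //; have [] := has_inf_superharmonic_value.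
  lra.
have [|u [u0 up uP]] := h (e / 2); first lra.
exists u; split=> // d; apply: le_trans (uP d).
by apply: ler_wpM2r => //; lra.
Qed.

(** The weights [u] vary with [e], but the minimizing actions range over a finite set, so one [f]
    serves every [e]. Legality is put under the quantifier so that the same selection yields it. *)
Lemma despot_optimal_choice : exists f : {ffun despot A -> alphabet A},
  forall e : R, 0 < e -> (forall d, despot_legal d (f d)) /\
       exists u, (forall d, 1 <= u d) /\
          forall d, despot_sum u d (f d) <= (game_value + e) * u d.
Proof.
apply: fin_uniform_choice => [f e1 e2 e12 [fl [u [u1 uP]]]
  |e /superharmonic_above[u [u1 uP]]].
  split=> //; exists u; split=> // d; apply: le_trans (uP d) _.
  by apply: ler_wpM2r; [exact: le_trans (u1 d) | rewrite lerD2l].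
exists [ffun d => despot_best u d]; split=> [d|].
  by rewrite ffunE; have [] := despot_bestP u d.
by exists u; split=> // d; rewrite ffunE; exact: uP.
Qed.

(** All legal [a] are covered because the opposing Despot may play arbitrarily; [despot_bestP]
    reduces them to the minimizing action. *)
Lemma tribune_optimal_choice : exists g : {ffun tribune A -> alphabet A},
  forall e : R, 0 < e -> (forall t, tribune_legal t (g t)) /\
       exists u, [/\ forall d, 0 <= u d, exists d, 0 < u d &
      forall d a, despot_legal d a -> (game_value - e) * u d <=
        \sum_(t | (d, a, t) \in despot_trans A) tribune_sum u t (g t)].
Proof.
apply: fin_uniform_choice => [g e1 e2 e12 [gl [u [u0 up uP]]]
  |e /subharmonic_below[u [u0 up uP]]].
  split=> //; exists u; split=> // d a al; apply: le_trans (uP d a al).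
  by apply: ler_wpM2r => //; rewrite lerD2l lerN2.
exists [ffun t => tribune_best u t]; split=> [t|].
  by rewrite ffunE; have [] := tribune_bestP u t.
exists u; split=> // d a al; apply: le_trans (uP d) _.
have [_ /(_ _ al) h] := despot_bestP u d; apply: le_trans h _.
by apply: ler_sum => t _; rewrite ffunE.
Qed.


End Game.

(** * Determinacy from the two positional strategies *)

Theorem theorem16 (R : realType) (A : arena) :
  exists V : R,
    [/\ has_value A (V%:E)%E,
        (exists s : despot_strategy A,
           despot_positional s /\ despot_optimal (V%:E)%E s)
      & (exists r : tribune_strategy A,
           tribune_positional r /\ tribune_optimal (V%:E)%E r)].
Proof.
have V0 : 0 <= game_value R A.
  apply: lb_le_inf; first by have [] := has_inf_superharmonic_value R A.
  by move=> l; exact: superharmonic_value_ge0.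
have [f fP] := despot_optimal_choice R A.
have [g gP] := tribune_optimal_choice R A.
(* The error [1] is arbitrary: only legality is extracted here. *)
have [fl _] := fP 1 ltr01; have [gl _] := gP 1 ltr01.
pose s := @DespotStrategy A (fun _ d => f d) (fun _ d => existsP (fl d)).
pose r := @TribuneStrategy A (fun _ _ _ t => g t) (fun _ _ _ t => existsP (gl t)).
have sopt : despot_optimal (game_value R A)%:E s.
  move=> r'; apply/lee_addgt0Pr => e e0; rewrite -EFinD.
  have [_ [u [u1 uP]]] := fP e e0.
  apply: (payoff_le (u := u)) => [|//|h d]; first by rewrite addr_ge0// ltW.
  apply: le_trans (uP d); apply: ler_sum => t _.
  (* Tribune's reply may depend on the history, but it is legal and so gains at most what
     [tribune_best] gains. *)
  have [_] := tribune_bestP u t; apply; apply/existsP; exact: tribune_choiceP.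
have ropt : tribune_optimal (game_value R A)%:E r.
  move=> s'; apply/lee_subgt0Pr => e e0; rewrite -EFinB.
  have [_ [u [u0 up uP]]] := gP e e0.
  apply: (payoff_ge (u := u)) => // h d; apply: uP.
  apply/existsP; exact: despot_choiceP.
have infsup_le : (ereal_inf [set ereal_sup [set payoff R s r | r in [set: tribune_strategy A]]
    | s in [set: despot_strategy A]] <= (game_value R A)%:E)%E.
  apply: ge_ereal_inf; exists (ereal_sup [set payoff R s r | r in [set: tribune_strategy A]]).
    by exists s.
  by apply: ge_ereal_sup => _ [r' _ <-].
have supinf_ge : ((game_value R A)%:E <= ereal_sup [set ereal_inf [set payoff R s r |
    s in [set: despot_strategy A]] | r in [set: tribune_strategy A]])%E.
  apply: le_ereal_sup_tmp; exists (ereal_inf [set payoff R s r | s in [set: despot_strategy A]]).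
    by exists r.
  by apply: le_ereal_inf_tmp => _ [s' _ <-].
(* Weak duality closes the circle: inf sup is at most the value, which is at most sup inf, so all
   three agree. *)
have minimax : (ereal_sup [set ereal_inf [set payoff R s r | s in [set: despot_strategy A]]
      | r in [set: tribune_strategy A]] <=
    ereal_inf [set ereal_sup [set payoff R s r | r in [set: tribune_strategy A]]
      | s in [set: despot_strategy A]])%E.
  apply: ge_ereal_sup => _ [r' _ <-]; apply: le_ereal_inf_tmp => _ [s' _ <-].
  apply: (@le_trans _ _ (payoff R s' r')).
    by apply: ereal_inf_lbound; exists s'.
  by apply: ereal_sup_ubound; exists r'.
exists (game_value R A); split.
- split; apply/le_anti/andP; split=> //.
    exact: le_trans supinf_ge minimax.
  exact: le_trans minimax infsup_le.
- by exists s; split=> //; exists f.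
- by exists r; split=> //; exists g.
Qed.
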